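(* Let $A$ be a non-empty set and let $v_1,v_2:A\to A$ be injective maps with $v:=v_1v_2=v_2v_1$, and assume that $v$ is a shift. Let $W=A\setminus v(A)$, $W_i=A\setminus v_i(A)$ for $i=1,2$, let $W_2^c=W\setminus W_2$, and let $u:W\to W$ be the bijection defined in the context. Then $(A,v,v_1,v_2)$ is in bijective correspondence with $(W\times\mathbb{Z}_+,1_W\times s_+,s_1,s_2)$, that is, there is a bijection $g:A\to W\times\mathbb{Z}_+$ with $gvg^{-1}=1_W\times s_+$, $gv_1g^{-1}=s_1$ and $gv_2g^{-1}=s_2$, where $$s_1(w,n)=\begin{cases}(u^{-1}(w),n),&w\in W_2,\\(u^{-1}(w),n+1),&w\in W_2^c,\end{cases}\qquad s_2(w,n)=\begin{cases}(u(w),n),&w\in u^{-1}(W_2^c),\\(u(w),n+1),&w\in u^{-1}(W_2),\end{cases}$$ for $(w,n)\in W\times\mathbb{Z}_+$.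
   Context: $\mathbb{Z}_+=\{0,1,2,\ldots\}$. An injective map $v:A\to A$ is a shift if $\bigcap_{n=0}^\infty v^n(A)=\emptyset$. The map $s_+:\mathbb{Z}_+\to\mathbb{Z}_+$ is $s_+(n)=n+1$, and $(1_W\times s_+)(w,n)=(w,n+1)$. With $v=v_1v_2=v_2v_1$ and $W,W_1,W_2$ as in the claim, one has the disjoint decompositions $W=W_1\sqcup v_1(W_2)=v_2(W_1)\sqcup W_2$. The bijection $u:W\to W$, viewed as a map from $W_1\sqcup v_1(W_2)$ to $v_2(W_1)\sqcup W_2$, is defined by $u(w_1)=v_2(w_1)$ for $w_1\in W_1$ and $u(v_1(w_2))=w_2$ for $w_2\in W_2$. *)

(* Defs.v *)
From mathcomp Require Import all_boot.
From mathcomp Require Import boolp classical_sets functions.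

Set Implicit Arguments.
Unset Strict Implicit.
Unset Printing Implicit Defensive.

Local Open Scope classical_set_scope.

Definition is_shift (A : Type) (v : A -> A) : Prop :=
  injective v /\ \bigcap_(n in [set: nat]) range (iter n v) = set0.

Definition wandering (A : Type) (v : A -> A) : set A := [set: A] `\` range v.

Definition id_times_succ (W : Type) (p : W * nat) : W * nat := (p.1, p.2.+1).

Section BijectionU.
Context (A : Type) (v v1 v2 : A -> A).
Context (inj1 : injective v1) (inj2 : injective v2).
Context (v12 : v = v1 \o v2) (v21 : v = v2 \o v1).

Let W := wandering v.
Let W1 := wandering v1.
Let W2 := wandering v2.

Lemma wanderingE : W = W1 `|` v1 @` W2.
Proof using inj1 v12.
rewrite /W /W1 /W2 /wandering v12 !setTD.
apply/seteqP; split=> [x /= Nx | x /= [Nx [y _ yx]|[y Ny <-] [z _ /inj1 zy]]].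
- have [[y _ yx]|] := pselect (range v1 x); last by left.
  right; exists y => //= -[z _ zy]; apply: Nx; exists z => //=.
  by rewrite zy.
- by apply: Nx; exists (v2 y).
- by apply: Ny; exists z.
Qed.

Lemma wanderingE' : W = v2 @` W1 `|` W2.
Proof using inj2 v21.
rewrite /W /W1 /W2 /wandering v21 !setTD.
apply/seteqP; split=> [x /= Nx | x /= [[y Ny <-] [z _ /inj2 zy]|Nx [y _ yx]]].
- have [[y _ yx]|] := pselect (range v2 x); last by right.
  left; exists y => //= -[z _ zy]; apply: Nx; exists z => //=.
  by rewrite zy.
- by apply: Ny; exists z.
- by apply: Nx; exists (v1 y).
Qed.

Lemma wandering_disj : W1 `&` v1 @` W2 = set0.
Proof using.
by rewrite /W1 /wandering -subset0 => x [[_ Nx] [y _ yx]]; apply: Nx; exists y.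
Qed.

Lemma wandering_disj' : v2 @` W1 `&` W2 = set0.
Proof using.
by rewrite /W2 /wandering -subset0 => x [[y _ yx] [_ Nx]]; apply: Nx; exists y.
Qed.

Lemma mem_wandering x : (W1 `|` v1 @` W2) x -> x \in W.
Proof using inj1 v12. by rewrite -wanderingE; exact: mem_set. Qed.

Lemma mem_wandering' x : (v2 @` W1 `|` W2) x -> x \in W.
Proof using inj2 v21. by rewrite -wanderingE'; exact: mem_set. Qed.

(* [ugraph w w'] reads u(w) = w': either w is in W1 and w' = v2(w), or
   w = v1(w') with w' in W2. *)
Definition ugraph (w w' : W) : Prop :=
  (W1 (val w) /\ val w' = v2 (val w)) \/
  (W2 (val w') /\ val w = v1 (val w')).

Lemma ugraph_total (w : W) : exists w', ugraph w w'.
Proof using inj1 inj2 v12 v21.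
have : W (val w) by apply/set_mem/valP.
rewrite {1}wanderingE => -[W1w|[w2 W2w2 v1w2]].
  have Wv2w : v2 (val w) \in W.
    by apply: mem_wandering'; left; exists (val w).
  by exists (SigSub Wv2w); left.
have Ww2 : w2 \in W by apply: mem_wandering'; right.
by exists (SigSub Ww2); right.
Qed.

Lemma ugraph_onto (w' : W) : exists w, ugraph w w'.
Proof using inj1 inj2 v12 v21.
have : W (val w') by apply/set_mem/valP.
rewrite {1}wanderingE' => -[[w1 W1w1 v2w1]|W2w'].
  have Ww1 : w1 \in W by apply: mem_wandering; left.
  by exists (SigSub Ww1); left.
have Wv1w' : v1 (val w') \in W.
  by apply: mem_wandering; right; exists (val w').
by exists (SigSub Wv1w'); right.
Qed.

Definition umap (w : W) : W := sval (cid (ugraph_total w)).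
Definition uinv (w : W) : W := sval (cid (ugraph_onto w)).

Lemma ugraph_fun w w' w'' : ugraph w w' -> ugraph w w'' -> w' = w''.
Proof using inj1.
move=> [[[_ N] e]|[a e]] [[[_ N'] e']|[a' e']]; apply: val_inj.
- by rewrite e e'.
- by case: N; exists (val w'').
- by case: N'; exists (val w').
- by apply: inj1; rewrite -e -e'.
Qed.

Lemma ugraph_inj w' w'' w : ugraph w' w -> ugraph w'' w -> w' = w''.
Proof using inj2.
move=> [[a e]|[[_ N] e]] [[a' e']|[[_ N'] e']]; apply: val_inj.
- by apply: inj2; rewrite -e -e'.
- by case: N'; exists (val w').
- by case: N; exists (val w'').
- by rewrite e e'.
Qed.

Lemma umapP w : ugraph w (umap w).
Proof using. by rewrite /umap; case: cid. Qed.

Lemma uinvP w : ugraph (uinv w) w.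
Proof using. by rewrite /uinv; case: cid. Qed.

Lemma umap_W1 (w : W) : W1 (val w) -> val (umap w) = v2 (val w).
Proof using.
move=> [_ N]; have [[_ //]|[_ e]] := umapP w.
by case: N; exists (val (umap w)).
Qed.

Lemma umap_v1W2 (w : W) (w2 : A) :
  W2 w2 -> val w = v1 w2 -> val (umap w) = w2.
Proof using.
move=> _ e; have [[[_ N] _]|[_ e']] := umapP w.
  by case: N; exists w2; last exact: esym.
by apply: inj1; rewrite -e'.
Qed.

Lemma umapK : cancel umap uinv.
Proof using. by move=> w; apply: ugraph_inj (uinvP _) (umapP w). Qed.

Lemma uinvK : cancel uinv umap.
Proof using. by move=> w; apply: ugraph_fun (umapP _) (uinvP w). Qed.

Let W2inW : set W := [set w : W | W2 (val w)].

Definition s1 (p : W * nat) : W * nat :=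
  if p.1 \in W2inW then (uinv p.1, p.2) else (uinv p.1, p.2.+1).

Definition s2 (p : W * nat) : W * nat :=
  if p.1 \in umap @^-1` (~` W2inW) then (umap p.1, p.2)
  else (umap p.1, p.2.+1).

End BijectionU.

(* Main.v *)
Require Import Defs.
From mathcomp Require Import all_boot.
From mathcomp Require Import boolp classical_sets functions.

(** The bijection is the Wold decomposition of the shift [v]: every point of
    [A] is [v^n w] for exactly one [n] and one [w] in the wandering set
    [W = A \ v(A)], so that [(w, n) |-> v^n w] ([wold]) identifies [A] with
    [W * nat] and carries [v] to [1 * s_+].

    Since [v1] and [v2] commute with [v], it is enough to know them on [W],
    where they are read off from the two clauses that define [u].
    - If [u w = v2 w] with [w] in [W1], then [v2 w = u w] stays in [W], while
      [v1 (u w) = v w] has moved up one level.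
    - If [w = v1 (u w)] with [u w] in [W2], then [v1 (u w) = w] stays in [W],
      while [v2 w = v (u w)] has moved up one level.
    These are the clauses of [s1] (at the point [u w]) and of [s2] (at [w]);
    membership of [u w] in [W2] tells the two cases apart. *)

Local Open Scope classical_set_scope.

Lemma iter_comm (T : Type) (f h : T -> T) (n : nat) (x : T) :
  (forall y, h (f y) = f (h y)) -> h (iter n f x) = iter n f (h x).
Proof. by move=> hf; elim: n => //= n IHn; rewrite hf IHn. Qed.

Definition wold {A : Type} {v : A -> A} (p : wandering v * nat) : A :=
  iter p.2 v (val p.1).

Lemma wandering_neq {A : Type} {v : A -> A} (w : wandering v) (x : A) :
  val w <> v x.
Proof. by move=> wx; have [_] := set_mem (valP w); apply; exists x. Qed.

(** Cancelling the common power of [v] leaves either an equality in [W] or a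
    point of [W] in the range of [v], which is absurd. *)
Lemma wold_inj {A : Type} {v : A -> A} : injective v -> injective (@wold A v).
Proof.
move=> vI [w m] [w' n]; rewrite /wold /=.
elim: m n => [|m IHm] [|n] /=.
- by move=> /val_inj->.
- by move=> e; have [] := wandering_neq _ _ e.
- by move=> e; have [] := wandering_neq _ _ (esym e).
- by move=> /vI/IHm[-> ->].
Qed.

(** A point outside [v^n(A)] can be pulled back along [v] fewer than [n]
    times; the point where this stops lies in [W]. The shift condition provides
    such an [n] for every point. *)
Lemma wold_surj {A : Type} {v : A -> A} (x : A) :
  is_shift v -> exists p, @wold A v p = x.
Proof.
move=> [_ capv0].
have [n nx] : exists n, ~ range (iter n v) x.
  apply/existsNP => allx.
  suff : (set0 : set A) x by [].
  by rewrite -capv0 => n _; exact: allx.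
elim: n x nx => [|n IHn] x nx; first by case: nx; exists x.
have [[y _ yx]|Nx] := pselect (range v x).
  have [|[w m] wy] := IHn y.
    by move=> [z _ zy]; apply: nx; exists z; rewrite //= zy.
  by exists (w, m.+1); rewrite -yx -wy.
have Wx : x \in wandering v by apply: mem_set.
by exists (SigSub Wx, 0).
Qed.

Section Intertwining.
Context (A : Type) (v v1 v2 : A -> A).
Context (inj1 : injective v1) (inj2 : injective v2).
Context (v12 : v = v1 \o v2) (v21 : v = v2 \o v1).

Let vE1 x : v1 (v2 x) = v x. Proof. by rewrite v12. Qed.
Let vE2 x : v2 (v1 x) = v x. Proof. by rewrite v21. Qed.

(** Commuting [v1] past [v^n] reduces the claim to the level [n = 0]. There the
    clause of [u] that holds at [u^-1 w] must match the test [w \in W2]: the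
    first clause puts [w] in [v2(A)], the second puts it in [W2]. *)
Lemma wold_s1 (p : wandering v * nat) :
  wold (s1 inj1 inj2 v12 v21 p) = v1 (wold p).
Proof.
case: p => w n; rewrite /wold /= iter_comm => [|y]; last first.
  by rewrite -(vE1 (v1 y)) vE2.
rewrite /s1 /=; have := uinvP inj1 inj2 v12 v21 w.
case: ifPn => [/set_mem W2w|/negP W2w] [[_ wE]|[W2w' wE]] /=.
- by case: W2w => _ []; exists (val (uinv inj1 inj2 v12 v21 w)).
- by rewrite wE.
- by rewrite -iterS iterSr wE vE1.
- by case: W2w; exact: mem_set.
Qed.

(** As for [wold_s1], with the clause of [u] at [w] matched against the test on
    [u w]. *)
Lemma wold_s2 (p : wandering v * nat) :
  wold (s2 inj1 inj2 v12 v21 p) = v2 (wold p).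
Proof.
case: p => w n; rewrite /wold /= iter_comm => [|y]; last first.
  by rewrite -(vE2 (v2 y)) vE1.
rewrite /s2 /=; have := umapP inj1 inj2 v12 v21 w.
case: ifPn => [/set_mem NW2|/negP NW2] [[_ uE]|[W2u wE]] /=.
- by rewrite uE.
- by case: NW2.
- case: NW2; apply: mem_set => -[_]; apply.
  by exists (val w).
- by rewrite -iterS iterSr wE vE2.
Qed.

End Intertwining.

Theorem theorem3p2 (A : Type) (A_nonempty : inhabited A) (v v1 v2 : A -> A)
    (inj1 : injective v1) (inj2 : injective v2)
    (v12 : v = v1 \o v2) (v21 : v = v2 \o v1)
    (v_shift : is_shift v) :
  exists (g : A -> wandering v * nat) (ginv : wandering v * nat -> A),
    [/\ cancel g ginv, cancel ginv g,
        g \o v \o ginv = @id_times_succ (wandering v),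
        g \o v1 \o ginv = s1 inj1 inj2 v12 v21 &
        g \o v2 \o ginv = s2 inj1 inj2 v12 v21].
Proof.
have [g gK] := choice (fun x => wold_surj x v_shift).
have woldK : cancel (@wold A v) g.
  by move=> p; apply: (wold_inj (proj1 v_shift)); rewrite gK.
exists g, (@wold A v); split => //; apply/funext => p.
- exact: (woldK (id_times_succ p)).
- by rewrite /= -(wold_s1 _ _ _ _ inj1 inj2 v12 v21) woldK.
- by rewrite /= -(wold_s2 _ _ _ _ inj1 inj2 v12 v21) woldK.
Qed.
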